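(* Let $\alpha>0$ and, for $\alpha\ne1$, let $c_1=1-\frac1{2\alpha}$, $c_2=\frac{\alpha}{1-\alpha}$. Consider the relative loss $r_d(T,\phi)$ after $T$ steps of (simplified) sign descent with step-size parameter $\phi\in[1,d]$ on the linear bigram problem with vocabulary size $d$ and power-law frequencies with exponent $\alpha$, as defined in the context. For scalings $T_d(\tau),\phi_d(\tau)$ let $r(\tau)=\lim_{d\to\infty}r_d(T_d(\tau),\phi_d(\tau))$. 1. If $\alpha<1/2$, with ($\tau>0$) $T_d(\tau)=\tau$ and $\phi_d(\tau)=d$ if $\tau^2\le\frac{1-c_1}{4c_2}$, $\phi_d(\tau)=d\,(c_1+4c_2\tau^2)^{-1}$ otherwise, one has $$r(\tau)=\begin{cases}2\alpha c_2&\text{if }\tau^2\le\frac{1-c_1}{4c_2},\\[2pt] \dfrac{(c_1+4c_2\tau^2)^{2\alpha}}{4\tau^2}&\text{otherwise,}\end{cases}\qquad\text{and}\quad r(\tau)\sim\frac{c_2^{2\alpha}}{(2\tau)^{2-4\alpha}}\ \text{ as }\tau\to\infty.$$ 2. If $\alpha=1/2$, with $T_d(\tau)=\frac12d^{\tau/2}$ and $\phi_d(\tau)=d^{1-\tau}$ where $\tau\in[0,1]$, one has $r(\tau)=1-\tau$. 3. If $\alpha>1/2$, with $T_d(\tau)=\frac12\tau\sqrt d$ ($\tau>0$) and $\phi_d(\tau)=1+\frac1{\tau^2}$ if both $\tau^2<(2^\alpha-1)^{-1}$ and $\alpha<1$, $\phi_d(\tau)=\left(1+\frac1{\tau^2}\right)^{1/\alpha}$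 otherwise, one has $$r(\tau)\sim\frac{1}{1+\zeta(2\alpha)\tau^2}\quad\text{as }\tau\to\infty.$$
   Context: Setting. In the linear bigram problem with vocabulary size $d$ and power-law frequencies, with $z=\sum_{k=1}^dk^{-\alpha}$, the token frequencies are $\pi_k=\frac1{zk^\alpha}$ and, for every $i\in[d]$, the conditional frequencies $\pi_{j|i}$ are, for some permutation $\rho_i$ of $[d]$, $\pi_{\rho_i(k)|i}=\frac1{zk^\alpha}$. The excess loss $\mathcal L_d-\mathcal L_d^*$ at parameters $\mathbf W\in\mathbb R^{d\times d}$ is, up to a constant factor irrelevant for ratios, $\sum_{i,j}\pi_i\delta_{ij}^2$, where $\delta_{ij}$ is the distance of $W_{ij}$ to the optimum; initialized at $\mathbf W=0$ one has $\delta_{ij}(0)=\pi_{j|i}$. The simplified sign descent dynamics with step-size $\eta>0$ are $$|\delta_{ij}(t)|=\begin{cases}|\delta_{ij}(0)|-t\eta&\text{if }|\delta_{ij}(t-1)|-\eta\ge0,\\ \eta/2&\text{otherwise.}\end{cases}$$ The step-size is parameterized as $\eta=\frac1{zT\phi^\alpha}$ with $1\le\phi\le d$, where $T$ is the total number of steps. The relative loss (loss after $T$ steps minus the minimum loss, divided by initial loss minus the minimum loss) is then $$r_d(T,\phi)=\frac{\sum_{k=1}^{\lfloor\phi\rfloor}\left(k^{-\alpha}-\phi^{-\alpha}\right)^2+\frac{d-\lfloor\phi\rfloor}{4T^2}\phi^{-2\alpha}}{\sum_{k=1}^dk^{-2\alpha}},$$ and this formula defines $r_d(T,\phi)$ for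 all real $T>0$. $\zeta$ is the Riemann zeta function; $f\sim g$ means $f/g\to1$. *)

(* Defs.v *)
From mathcomp Require Export all_boot all_order all_algebra.
From mathcomp Require Export all_classical all_reals all_analysis.
Export Order.TTheory GRing.Theory Num.Theory.
Export numFieldNormedType.Exports.

Set Implicit Arguments.
Unset Strict Implicit.
Unset Printing Implicit Defensive.

Local Open Scope classical_set_scope.
Local Open Scope ring_scope.

(* Relative loss r_d(T, phi) of simplified sign descent with step-size
   eta = 1 / (z T phi^alpha) on the linear bigram problem.  A coordinate with
   frequency 1 / (z k^alpha) ends at distance (k^-alpha - phi^-alpha) / z from
   the optimum if k <= phi, and at distance eta / 2 otherwise; this is the
   weighted sum of squared distances divided by its initial value, and it makes
   sense for real T.  For phi >= 0, Num.truncn phi is the floor of phi, and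
   d - floor phi is a real difference, not a truncated one. *)
Definition rel_loss (R : realType) (alpha : R) (d : nat) (T phi : R) : R :=
  (\sum_(1 <= k < (Num.truncn phi).+1) (k%:R `^ (- alpha) - phi `^ (- alpha)) ^+ 2
     + (d%:R - (Num.truncn phi)%:R) / (4 * T ^+ 2) * phi `^ (- (2 * alpha)))
  / \sum_(1 <= k < d.+1) k%:R `^ (- (2 * alpha)).

(* limn is total: a statement about lim_rel_loss is meaningful only together
   with rel_loss_cvg. *)
Definition rel_loss_cvg (R : realType) (alpha : R) (T phi : nat -> R -> R)
    (tau : R) : Prop :=
  cvgn (fun d : nat => rel_loss alpha d (T d tau) (phi d tau)).

Definition lim_rel_loss (R : realType) (alpha : R) (T phi : nat -> R -> R)
    (tau : R) : R :=
  limn (fun d : nat => rel_loss alpha d (T d tau) (phi d tau)).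

(* The step-size parameter must lie in [1, d]; since only the limit d -> oo
   matters, this is required for all large d. *)
Definition admissible (R : realType) (phi : nat -> R -> R) (tau : R) : Prop :=
  \forall d \near \oo, 1 <= phi d tau <= d%:R.

Definition asymp_equiv (R : realType) (f g : R -> R) : Prop :=
  f tau / g tau @[tau --> +oo] --> (1 : R).

(* The Riemann zeta function on reals s > 1. *)
Definition zeta (R : realType) (s : R) : R :=
  limn (series (fun k : nat => k.+1%:R `^ (- s))).

(* Main.v *)
Require Import Defs.
From mathcomp Require Import ring lra.
Set Implicit Arguments.
Unset Strict Implicit.
Unset Printing Implicit Defensive.
Local Open Scope classical_set_scope.
Local Open Scope ring_scope.

(* Write P(s, n) for the sum of k^-s over 1 <= k <= n.  Expanding the square,
   the numerator of r_d is a combination of P(2 alpha, n), P(alpha, n) and n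
   with n = floor phi.  For 0 <= s < 1 the mean value theorem gives
   |(1 - s) P(s, floor x) - x^(1-s)| <= 1, and likewise
   |P(1, floor x) - ln x| <= 1, so when alpha < 1/2 every term has order
   d^(1 - 2 alpha), while when alpha = 1/2 numerator and denominator are
   (1 - tau) ln d + O(1) and ln d + O(1).  When alpha > 1/2, phi does not depend
   on d and only the denominator, tending to zeta(2 alpha), and the factor
   (d - n) / d vary; for large tau one has 1 <= phi < 2, so n = 1 and
   r(tau) = 1 / (zeta(2 alpha) (1 + tau^2)). *)

(** * Limits of ratios, powers and logarithms at infinity *)

(** Once [v] is positive, [u / v] lies within [C / v] of [a], and [C / v] tends to 0. This turns
    each O(1) estimate below into a limit of a quotient. *)
Lemma cvg_ratio_bounded_diff (R : realType) (T : Type) (F : set_system T)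
    {FF : Filter F} (u v : T -> R) (a C : R) :
  v x @[x --> F] --> +oo -> (\forall x \near F, `|u x - a * v x| <= C) ->
  u x / v x @[x --> F] --> a.
Proof.
move=> vy uv.
have v_gt0 : \forall x \near F, 0 < v x by move/cvgryPgt: vy; exact.
have Cv0 : C / v x @[x --> F] --> 0.
  rewrite -[0](mulr0 C); apply: cvgM; first exact: cvg_cst.
  exact/gtr0_cvgV0.
have lo : a - C / v x @[x --> F] --> a.
  by rewrite -{2}[a]subr0; apply: cvgB => //; exact: cvg_cst.
have hi : a + C / v x @[x --> F] --> a.
  by rewrite -{2}[a]addr0; apply: cvgD => //; exact: cvg_cst.
apply: squeeze_cvgr lo hi; near=> x.
have vx : 0 < v x by near: x.
have : `|u x - a * v x| <= C by near: x.
rewrite ler_norml => /andP[l h].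
rewrite ler_pdivlMr// ler_pdivrMr// mulrBl mulrDl !divfK ?gt_eqF//.
by apply/andP; split; lra.
Unshelve. all: by end_near. Qed.

Lemma powR_cvgy (R : realType) (p : R) : 0 < p -> x `^ p @[x --> +oo] --> +oo.
Proof.
move=> p0; apply/cvgryPgt => A; near=> x.
have x1 : (`|A| + 1) `^ p^-1 < x.
  by near: x; apply: nbhs_pinfty_gt; exact: num_real.
have A1 : 0 <= `|A| + 1 by rewrite addr_ge0.
have xp : ((`|A| + 1) `^ p^-1) `^ p < x `^ p.
  by apply: gt0_ltr_powR => //; rewrite nnegrE ?powR_ge0// ltW// (le_lt_trans _ x1)// powR_ge0.
rewrite -powRrM mulVf ?gt_eqF// powRr1// in xp.
by apply: le_lt_trans xp; rewrite (le_trans (ler_norm A))// lerDl.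
Unshelve. all: by end_near. Qed.

Lemma ln_cvgy (R : realType) : ln x @[x --> +oo] --> (+oo : set_system R).
Proof.
apply/cvgryPgt => A; near=> x.
have xA : expR A < x by near: x; apply: nbhs_pinfty_gt; exact: num_real.
have x0 : 0 < x := lt_trans (expR_gt0 A) xA.
by rewrite -(expRK A) ltr_ln// posrE// expR_gt0.
Unshelve. all: by end_near. Qed.

Lemma sqr_cvgy (R : realType) : x ^+ 2 @[x --> +oo] --> (+oo : set_system R).
Proof.
have lim := @powR_cvgy R 2 (ltr0Sn R 1).
apply: cvg_trans lim; apply: near_eq_cvg; near=> x.
rewrite powR_mulrn//; near: x; apply: nbhs_pinfty_ge; exact: num_real.
Unshelve. all: by end_near. Qed.

Lemma continuous_powR_base (R : realType) (p x : R) :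
  0 < x -> {for x, continuous (fun y : R => y `^ p)}.
Proof.
move=> x0; apply: differentiable_continuous; apply/derivable1_diffP.
by apply: derivable_powR; rewrite in_itv/= x0.
Qed.

(** Mean value theorem for y^(1-s) on [x, x+1]: [v] is c^-s at the intermediate point c. The sign of
    1 - s is left free, so both the growth bounds for s < 1 and the boundedness for s > 1 follow by
    telescoping. *)
Lemma powR_increment (R : realType) (s x : R) : 0 <= s -> 0 < x ->
  exists2 v, (x + 1) `^ (- s) <= v <= x `^ (- s) &
    (x + 1) `^ (1 - s) - x `^ (1 - s) = (1 - s) * v.
Proof.
move=> s0 x0; have xx1 : x < x + 1 by rewrite ltrDl.
have [y yx| |c] := @MVT R (fun y => y `^ (1 - s)) (fun y => (1 - s) * y `^ (1 - s - 1)) _ _ xx1.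
- by apply: is_derive1_powR; move: yx; rewrite in_itv/= => /andP[/(lt_trans x0)].
- apply: continuous_in_subspaceT => y; rewrite inE/= in_itv/= => /andP[xy _].
  exact/continuous_powR_base/(lt_le_trans x0).
rewrite in_itv/= => /andP[xc cx1] ->.
exists (c `^ (- s)); last first.
  by rewrite [x + 1]addrC addrK mulr1; congr (_ * _ `^ _); ring.
have c0 := lt_trans x0 xc; have x10 := lt_trans c0 cx1.
rewrite !powRN !lef_pV2 ?posrE ?powR_gt0//.
by rewrite !ge0_ler_powR// ?nnegrE ltW.
Qed.

(** * Partial sums of k^-s *)

Section power_sum.
Variable R : realType.
Implicit Types (s x : R) (n : nat).

Definition power_sum s n : R := \sum_(1 <= k < n.+1) k%:R `^ (- s).

Lemma power_sum0 s : power_sum s 0 = 0.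
Proof. by rewrite /power_sum big_geq. Qed.

Lemma power_sumS s n : power_sum s n.+1 = power_sum s n + n.+1%:R `^ (- s).
Proof. by rewrite /power_sum big_nat_recr. Qed.

Lemma power_sum_ge1 s n : (0 < n)%N -> 1 <= power_sum s n.
Proof.
move=> n0; rewrite /power_sum big_ltn// powR1 lerDl.
by apply: sumr_ge0 => k _; exact: powR_ge0.
Qed.

(** Lets floor phi be treated as the partial sum of exponent 0, so that one limit lemma covers all
    three sums in the numerator. *)
Lemma power_sum_exp0 n : power_sum 0 n = n%:R.
Proof.
elim: n => [|n IH]; first exact: power_sum0.
by rewrite power_sumS IH oppr0 powRr0 natr1.
Qed.

Lemma power_sum_ge s n : 0 <= s < 1 ->
  n.+1%:R `^ (1 - s) - 1 <= (1 - s) * power_sum s n.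
Proof.
move=> /andP[s0 s1]; elim: n => [|n IH].
  by rewrite power_sum0 powR1 mulr0 subrr.
have [v /andP[_ hv] e] := powR_increment s0 (ltr0Sn R n).
rewrite power_sumS -[in X in X <= _]natr1.
have : (1 - s) * v <= (1 - s) * n.+1%:R `^ (- s) by rewrite ler_wpM2l// subr_ge0 ltW.
by move: IH e; lra.
Qed.

Lemma power_sum_le s n : 0 <= s < 1 ->
  (1 - s) * power_sum s n <= n%:R `^ (1 - s).
Proof.
move=> /andP[s0 s1]; elim: n => [|n IH].
  by rewrite power_sum0 mulr0 powR_ge0.
(* The term k = 1 is compared directly, using 1 - s <= 1: its interval [0, 1] starts at 0, outside
   the range of [powR_increment]. *)
rewrite power_sumS; case: n IH => [|n] IH.
  by rewrite power_sum0 !powR1; lra.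
have [v /andP[hv _] e] := powR_increment s0 (ltr0Sn R n).
rewrite natr1 in hv e.
have : (1 - s) * n.+2%:R `^ (- s) <= (1 - s) * v by rewrite ler_wpM2l// subr_ge0 ltW.
by move: IH e; lra.
Qed.

(** With n = floor x, x^(1-s) lies between n^(1-s) and (n+1)^(1-s), so the two preceding bounds
    place the difference in [-1, 0]. *)
Lemma power_sum_truncn_bound s x : 0 <= s < 1 -> 0 <= x ->
  `|(1 - s) * power_sum s (Num.truncn x) - x `^ (1 - s)| <= 1.
Proof.
move=> s01 x0; have /andP[nx xn] := truncn_itv x0.
have le := power_sum_le (Num.truncn x) s01.
have ge := power_sum_ge (Num.truncn x) s01.
have p0 : 0 <= 1 - s by case/andP: s01 => _ s1; rewrite subr_ge0 ltW.
have h1 : (Num.truncn x)%:R `^ (1 - s) <= x `^ (1 - s).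
  by rewrite ge0_ler_powR// nnegrE.
have h2 : x `^ (1 - s) <= (Num.truncn x).+1%:R `^ (1 - s).
  by rewrite ge0_ler_powR// ?nnegrE// ltW.
by rewrite ler_norml; apply/andP; split; lra.
Qed.

Lemma power_sum_truncn_cvg (T : Type) (F : set_system T) {FF : Filter F}
    (f : T -> R) s : 0 <= s < 1 -> f t @[t --> F] --> +oo ->
  power_sum s (Num.truncn (f t)) / f t `^ (1 - s) @[t --> F] --> (1 - s)^-1.
Proof.
move=> s01 fy; have p0 : 0 < 1 - s by case/andP: s01; rewrite subr_gt0.
(* The constant is the bound 1 of [power_sum_truncn_bound] divided by 1 - s. *)
apply: (@cvg_ratio_bounded_diff _ _ _ _ _ (fun t => f t `^ (1 - s)) _ (1 - s)^-1).
  exact: cvg_comp fy (powR_cvgy p0).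
near=> t; have ft : 0 <= f t by near: t; move/cvgryPge: fy; exact.
rewrite -(ler_pM2l p0) -[X in X * `|_|]gtr0_norm// -normrM mulrBr mulrA.
by rewrite divff ?gt_eqF// mul1r power_sum_truncn_bound.
Unshelve. all: by end_near. Qed.

(** At s = 1 the power y^(1-s) is constant and the logarithm takes its place. The induction step is
    ln (1 + h) <= h at h = 1/(n+1); the upper bound below uses h = -1/(n+2). *)
Lemma harmonic_sum_ge n : ln n.+1%:R <= power_sum 1 n.
Proof.
elim: n => [|n IH]; first by rewrite power_sum0 ln1.
rewrite power_sumS powR_inv1// -[n.+2%:R]natr1.
have -> : n.+1%:R + 1 = n.+1%:R * (1 + n.+1%:R^-1) :> R.
  by rewrite mulrDr mulr1 divff.
rewrite lnM ?posrE ?addr_gt0// lerD// le_ln1Dx//.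
by rewrite (@lt_le_trans _ _ 0)// ?ltrN10.
Qed.

Lemma harmonic_sum_le n : power_sum 1 n.+1 <= 1 + ln n.+1%:R.
Proof.
elim: n => [|n IH]; first by rewrite power_sumS power_sum0 powR1 ln1; lra.
rewrite power_sumS powR_inv1//.
have : ln (n.+1%:R / n.+2%:R) <= - n.+2%:R^-1 :> R.
  have -> : n.+1%:R / n.+2%:R = 1 + - n.+2%:R^-1 :> R.
    by rewrite -[n.+1%:R](addrK 1) natr1 mulrDl divff// mulNr div1r.
  by rewrite le_ln1Dx// ltrN2 invf_lt1// ltr1n.
rewrite ln_div ?posrE// lerBlDr addrC => h.
by rewrite (le_trans (lerD IH (lexx _)))// -addrA lerD2l -lerBrDr.
Qed.

Lemma harmonic_sum_truncn_bound x : 1 <= x ->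
  `|power_sum 1 (Num.truncn x) - ln x| <= 1.
Proof.
move=> x1; have x0 : 0 < x by rewrite (lt_le_trans _ x1).
have /andP[nx xn] := truncn_itv (ltW x0).
have := x1; rewrite -truncn_gt0.
case: (Num.truncn x) nx xn => // n nx xn _.
have le := harmonic_sum_le n; have ge := harmonic_sum_ge n.+1.
have h1 : ln n.+1%:R <= ln x by rewrite ler_ln ?posrE.
have h2 : ln x <= ln n.+2%:R by rewrite ler_ln ?posrE// ltW.
by rewrite ler_norml; apply/andP; split; lra.
Qed.

Lemma power_sum_series s n :
  power_sum s n = series (fun k : nat => k.+1%:R `^ (- s)) n.
Proof. by rewrite /power_sum seriesEnat/= big_add1. Qed.

Lemma power_sum_bounded s n : 1 < s -> power_sum s n <= s / (s - 1).
Proof.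
move=> s1; have s10 : 0 < s - 1 by rewrite subr_gt0.
(* Subtracting the boundary term (n+1)^(1-s) makes the induction telescope; at n = 0 both sides
   equal s - 1. *)
suff H : (s - 1) * power_sum s n.+1 <= s - n.+1%:R `^ (1 - s).
  rewrite ler_pdivlMr// mulrC; apply: (@le_trans _ _ ((s - 1) * power_sum s n.+1)).
    by rewrite ler_pM2l// power_sumS lerDl powR_ge0.
  by rewrite (le_trans H)// gerBl powR_ge0.
elim: n => [|n IH]; first by rewrite power_sumS power_sum0 !powR1; lra.
have [v /andP[hv _] e] := powR_increment (ltW (lt_trans ltr01 s1)) (ltr0Sn R n).
rewrite natr1 in hv e; rewrite power_sumS.
have : (s - 1) * n.+2%:R `^ (- s) <= (s - 1) * v by rewrite ler_pM2l.
by move: IH e; lra.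
Qed.

(** [zeta] is defined through the total [limn]; bounded monotone partial sums show that it is a
    genuine limit. *)
Lemma power_sum_cvg_zeta s : 1 < s -> power_sum s n @[n --> \oo] --> zeta s.
Proof.
move=> s1; under eq_fun do rewrite power_sum_series.
apply/cvg_ex; exists (zeta s); apply: nondecreasing_is_cvgn.
  by apply: nondecreasing_series => n _ _; exact: powR_ge0.
exists (s / (s - 1)) => _ [n _ <-]; rewrite -power_sum_series.
exact: power_sum_bounded.
Qed.

Lemma zeta_gt0 s : 1 < s -> 0 < zeta s.
Proof.
move=> s1; apply: (@lt_le_trans _ _ 1) => //.
have cz := power_sum_cvg_zeta s1.
rewrite -(cvg_lim (@Rhausdorff R) cz); apply: limr_ge; first by apply/cvg_ex; exists (zeta s).
by near=> n; apply: power_sum_ge1; near: n; exists 1%N.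
Unshelve. all: by end_near. Qed.

End power_sum.

(** * The relative loss in terms of partial sums *)

Lemma powR_sqr (R : realType) (x p : R) : (x `^ p) ^+ 2 = x `^ (2 * p).
Proof. by rewrite -powR_mulrn ?powR_ge0// -powRrM mulrC. Qed.

Lemma rel_lossE (R : realType) (alpha : R) d (T phi : R) :
  let n := Num.truncn phi in
  rel_loss alpha d T phi =
  (power_sum (2 * alpha) n - 2 * phi `^ (- alpha) * power_sum alpha n
   + n%:R * phi `^ (- (2 * alpha))
   + (d%:R - n%:R) / (4 * T ^+ 2) * phi `^ (- (2 * alpha)))
  / power_sum (2 * alpha) d.
Proof.
move=> n; rewrite /rel_loss -/n; congr ((_ + _) / _).
under eq_bigr do rewrite sqrrB !powR_sqr !mulrN.
rewrite big_split/= sumrB big_const_nat subn1 iter_addr_0.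
congr (_ - _ + _); last by rewrite mulr_natl.
rewrite /power_sum mulr_sumr.
by apply: eq_bigr => k _; ring.
Qed.

(** * The regime alpha < 1/2 *)

(** The normalized sums of exponents 2 alpha, alpha and 0 tend to the respective 1/(1-s). The first
    summand of the limit is (1 - 2 alpha) (1/(1 - 2 alpha) - 2/(1 - alpha) + 1), from the
    coordinates k <= phi; the second comes from those left at distance eta/2. *)
Lemma rel_loss_sublinear_cvg (R : realType) (alpha T x : R) :
  0 < alpha < 1 / 2 -> 0 < T -> 0 < x ->
  rel_loss alpha d T (d%:R * x) @[d --> \oo] -->
  x `^ (1 - 2 * alpha) * (2 * alpha * (alpha / (1 - alpha))
    + (1 - 2 * alpha) * (x^-1 - 1) / (4 * T ^+ 2)).
Proof.
move=> /andP[a0 a12] T0 x0.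
pose phi d : R := d%:R * x; pose n d := Num.truncn (phi d).
have phiy : phi d @[d --> \oo] --> +oo.
  apply/cvgryPge => A; near=> d; rewrite /phi -ler_pdivrMr//.
  by near: d; exact: nbhs_infty_ger.
have cdy : (d%:R : R) @[d --> \oo] --> +oo by exact: cvgr_idn.
have h2 : 0 <= 2 * alpha < 1 by lra.
have h1 : 0 <= alpha < 1 by lra.
have h0 : 0 <= (0 : R) < 1 by rewrite lexx ltr01.
have P2 := power_sum_truncn_cvg h2 phiy.
have P1 := power_sum_truncn_cvg h1 phiy.
have P0 := power_sum_truncn_cvg h0 phiy.
have Pd := power_sum_truncn_cvg h2 cdy.
(* Numerator and denominator are both divided by (d x)^(1 - 2 alpha), and d / phi is the constant
   1/x. *)
have lim : (power_sum (2 * alpha) (n d) / phi d `^ (1 - 2 * alpha)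
    - 2 * (power_sum alpha (n d) / phi d `^ (1 - alpha))
    + power_sum 0 (n d) / phi d `^ (1 - 0)
    + (x^-1 - power_sum 0 (n d) / phi d `^ (1 - 0)) / (4 * T ^+ 2))
   / (power_sum (2 * alpha) (Num.truncn (d%:R : R)) / d%:R `^ (1 - 2 * alpha)
      / x `^ (1 - 2 * alpha)) @[d --> \oo] -->
   ((1 - 2 * alpha)^-1 - 2 * (1 - alpha)^-1 + (1 - 0)^-1
     + (x^-1 - (1 - 0)^-1) / (4 * T ^+ 2))
   / ((1 - 2 * alpha)^-1 / x `^ (1 - 2 * alpha)).
  apply: cvgM.
    apply: cvgD.
      apply: cvgD; last exact: P0.
      by apply: cvgB; [exact: P2|apply: cvgMr; exact: P1].
    by apply: cvgMl; apply: cvgB; [exact: cvg_cst|exact: P0].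
  apply: cvgV; last by apply: cvgMl; exact: Pd.
  by rewrite mulf_neq0// invr_eq0 ?gt_eqF ?powR_gt0//; lra.
rewrite (_ : _ * _ = ((1 - 2 * alpha)^-1 - 2 * (1 - alpha)^-1 + (1 - 0)^-1
     + (x^-1 - (1 - 0)^-1) / (4 * T ^+ 2))
   / ((1 - 2 * alpha)^-1 / x `^ (1 - 2 * alpha))); last first.
  rewrite subr0; field.
  by rewrite !gt_eqF ?powR_gt0//; lra.
apply: cvg_trans lim; apply: near_eq_cvg; near=> d.
have d0 : 0 < (d%:R : R) by near: d; exact: nbhs_infty_gtr.
have phi0 : 0 < phi d by rewrite mulr_gt0.
rewrite rel_lossE -/(phi d) -/(n d) natrK power_sum_exp0 subr0 powRr1 ?ltW//.
rewrite powRN.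
have powB z r : 0 < z -> (z : R) `^ (1 - r) = z / z `^ r.
  by move=> z0; rewrite powRB ?(lt0r_neq0 z0) ?implybT// powRr1// ltW.
have -> : d%:R `^ (1 - 2 * alpha) = phi d `^ (1 - 2 * alpha) / x `^ (1 - 2 * alpha).
  by rewrite powRM ?ltW// mulfK// gt_eqF ?powR_gt0.
(* Only phi, x and their alpha-th powers remain besides the partial sums, which leaves a rational
   identity. *)
rewrite powRN !powB// -!powR_sqr.
have := power_sum_ge1 (2 * alpha) (_ : 0 < d)%N; rewrite -(ltr0n R) => /(_ d0) P_ge1.
have P0' : power_sum (2 * alpha) d != 0 by rewrite gt_eqF// (lt_le_trans ltr01).
move: (powR_gt0 alpha phi0) (powR_gt0 alpha x0) => /lt0r_neq0 + /lt0r_neq0.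
move: (phi d `^ alpha) => p; rewrite /phi => p0 xa0.
field.
by rewrite xa0 p0 P0' !gt_eqF.
Unshelve. all: by end_near. Qed.

(** The comparison function equals (4 c2 tau^2)^(2 alpha) / (4 tau^2), so the quotient is the (2
    alpha)-th power of (c1 + 4 c2 tau^2) / (4 c2 tau^2), whose limit is 1. *)
Lemma rel_loss_sublinear_asymp (R : realType) (alpha c1 c2 : R) :
  0 < c2 ->
  asymp_equiv (fun tau => (c1 + 4 * c2 * tau ^+ 2) `^ (2 * alpha) / (4 * tau ^+ 2))
   (fun tau => c2 `^ (2 * alpha) / (2 * tau) `^ (2 - 4 * alpha)).
Proof.
move=> c20; rewrite /asymp_equiv.
have v_cvgy : 4 * c2 * tau ^+ 2 @[tau --> +oo] --> +oo.
  by apply: gt0_cvgMry (@sqr_cvgy R); rewrite mulr_gt0.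
have ratio : (c1 + 4 * c2 * tau ^+ 2) / (4 * c2 * tau ^+ 2) @[tau --> +oo] --> (1 : R).
  apply: (cvg_ratio_bounded_diff (C := `|c1|)) => //.
  by near=> tau; rewrite mul1r addrK.
have lim : ((c1 + 4 * c2 * tau ^+ 2) / (4 * c2 * tau ^+ 2)) `^ (2 * alpha)
    @[tau --> +oo] --> (1 : R) `^ (2 * alpha).
  exact: (continuous_cvg _ (@continuous_powR_base R (2 * alpha) 1 ltr01) ratio).
rewrite powR1 in lim.
apply: cvg_trans lim; apply: near_eq_cvg; near=> tau.
have t0 : 0 < tau by near: tau; apply: nbhs_pinfty_gt; exact: num_real.
have cv : 0 < c1 + 4 * c2 * tau ^+ 2.
  rewrite -ltrBlDl sub0r; near: tau; move/cvgryPgt: v_cvgy; exact.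
have v0 : 0 < 4 * c2 * tau ^+ 2 by rewrite !mulr_gt0// exprn_gt0.
have vr : (4 * c2 * tau ^+ 2) `^ (2 * alpha) = c2 `^ (2 * alpha) * (2 * tau) `^ (4 * alpha).
  have -> : 4 * c2 * tau ^+ 2 = c2 * (2 * tau) `^ 2%:R.
    by rewrite powR_mulrn ?mulr_ge0 ?ltW//; ring.
  by rewrite powRM ?powR_ge0 ?ltW// -powRrM; congr (_ * _ `^ _); ring.
have tt : (2 * tau) `^ (2 - 4 * alpha) = (2 * tau) ^+ 2 / (2 * tau) `^ (4 * alpha).
  rewrite powRB ?powR_mulrn ?mulr_ge0 ?ltW//.
  by rewrite mulf_eq0 negb_or pnatr_eq0 (lt0r_neq0 t0) implybT.
have -> : (4 * c2 * tau ^+ 2)^-1 = (4 * c2 * tau ^+ 2) `^ (- 1).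
  by rewrite powR_inv1// ltW.
rewrite powRM ?powR_ge0 ?ltW// -powRrM mulN1r powRN vr tt.
have c2a : c2 `^ (2 * alpha) != 0 by rewrite gt_eqF ?powR_gt0.
have ta : (2 * tau) `^ (4 * alpha) != 0 by rewrite gt_eqF ?powR_gt0 ?mulr_gt0.
by field; rewrite c2a ta gt_eqF.
Unshelve. all: by end_near. Qed.

(** * The regime alpha = 1/2 *)

Lemma rel_loss_critical_cvg (R : realType) (tau : R) : 0 <= tau <= 1 ->
  rel_loss (1 / 2) d (1 / 2 * d%:R `^ (tau / 2)) (d%:R `^ (1 - tau))
    @[d --> \oo] --> 1 - tau.
Proof.
move=> /andP[tau0 tau1].
pose phi d : R := d%:R `^ (1 - tau); pose n d := Num.truncn (phi d).
have two2 : 2 * (1 / 2) = 1 :> R by rewrite mul1r divff.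
(* The numerator of the loss: here 4 T^2 phi = d, so its last term becomes (d - n) / d. *)
pose N d := power_sum (1 : R) (n d) - 2 * phi d `^ (- (1 / 2)) * power_sum (1 / 2) (n d)
  + (n d)%:R / phi d + (d%:R - (n d)%:R) / d%:R.
have lny : ln (d%:R : R) @[d --> \oo] --> +oo by apply: cvg_comp (@ln_cvgy R); exact: cvgr_idn.
(* The constant 5 is 1 for the harmonic sum plus 4 for the cross term. The two quotients lie in
   [0, 1] and only push upwards, where the deviation is at most 3. *)
have cvN : N d / ln d%:R @[d --> \oo] --> 1 - tau.
  apply: (cvg_ratio_bounded_diff (C := 5)) lny _; near=> d.
  have d1 : 1 <= (d%:R : R) by near: d; exact: nbhs_infty_ger.
  have d0 : 0 < (d%:R : R) := lt_le_trans ltr01 d1.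
  have phi1 : 1 <= phi d by rewrite /phi -[leLHS](powRr0 d%:R) ler_powR// subr_ge0.
  have phid : phi d <= d%:R by rewrite /phi -[leRHS]powRr1 ?(ltW d0)// ler_powR// gerBl.
  have phi0 : 0 < phi d := lt_le_trans ltr01 phi1.
  have /andP[nphi _] := truncn_itv (ltW phi0).
  have := harmonic_sum_truncn_bound phi1; rewrite -/(n d) ler_norml ln_powR => /andP[h1 h2].
  have half : 0 <= (1 / 2 : R) < 1 by lra.
  have s0 : 0 <= power_sum (1 / 2 : R) (n d) by apply: sumr_ge0 => k _; exact: powR_ge0.
  have sle : power_sum (1 / 2) (n d) <= 2 * phi d `^ (1 / 2).
    have := power_sum_le (n d) half.
    have : (n d)%:R `^ (1 / 2) <= phi d `^ (1 / 2).
      by rewrite ge0_ler_powR// ?nnegrE ?(ltW phi0)//; lra.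
    have -> : 1 - 1 / 2 = 1 / 2 :> R by field.
    by lra.
  have m0 : 0 <= phi d `^ (- (1 / 2)) * power_sum (1 / 2) (n d) by rewrite mulr_ge0 ?powR_ge0.
  have m1 : phi d `^ (- (1 / 2)) * power_sum (1 / 2) (n d) <= 2.
    rewrite powRN mulrC ler_pdivrMr// ?powR_gt0//.
  have q0 : 0 <= (n d)%:R / phi d by rewrite divr_ge0// ltW.
  have q1 : (n d)%:R / phi d <= 1 by rewrite ler_pdivrMr// mul1r.
  have r0 : 0 <= (d%:R - (n d)%:R) / d%:R :> R.
    by rewrite divr_ge0 ?(ltW d0)// subr_ge0 (le_trans nphi).
  have r1 : (d%:R - (n d)%:R) / d%:R <= 1 :> R by rewrite ler_pdivrMr// mul1r gerBl.
  move: h1 h2 m0 m1 q0 q1 r0 r1; rewrite /N -mulrA.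
  move: (_ / phi d) (_ / d%:R) (phi d `^ _ * _) (power_sum 1 _) (ln _) => a b c e f *.
  by rewrite ler_norml; apply/andP; split; lra.
have cvP : power_sum 1 d / ln (d%:R : R) @[d --> \oo] --> (1 : R).
  apply: (cvg_ratio_bounded_diff (C := 1)) lny _; near=> d.
  have d1 : 1 <= (d%:R : R) by near: d; exact: nbhs_infty_ger.
  by have := harmonic_sum_truncn_bound d1; rewrite natrK mul1r.
have lim : (N d / ln d%:R) / (power_sum 1 d / ln d%:R) @[d --> \oo] --> (1 - tau) / 1.
  by apply: cvgM => //; apply: cvgV => //; exact: oner_neq0.
rewrite divr1 in lim; apply: cvg_trans lim; apply: near_eq_cvg; near=> d.
have ln0 : 0 < ln (d%:R : R) by near: d; move/cvgryPgt: lny; exact.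
have d0 : 0 < (d%:R : R) by near: d; exact: nbhs_infty_gtr.
have phi0 : 0 < phi d by rewrite powR_gt0.
rewrite rel_lossE -/(phi d) -/(n d) two2 powR_inv1 ?ltW//.
have ratio_ln (p q : R) : p / ln d%:R / (q / ln d%:R) = p / q.
  by rewrite invf_div mulrA divfK ?(lt0r_neq0 ln0).
rewrite ratio_ln; congr (_ / _); rewrite /N; congr (_ + _).
have -> : 4 * (1 / 2 * d%:R `^ (tau / 2)) ^+ 2 = d%:R `^ tau :> R.
  by rewrite exprMn powR_sqr [2 * _]mulrC divfK//; field.
have e : d%:R `^ tau * phi d = d%:R.
  by rewrite /phi -powRD addrC ?subrK ?powRr1 ?(ltW d0)// (lt0r_neq0 d0) implybT.
by rewrite -mulrA -invfM e.
Unshelve. all: by end_near. Qed.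

(** * The regime alpha > 1/2 *)

Lemma rel_loss_supercritical_cvg (R : realType) (alpha tau phi : R) :
  1 / 2 < alpha -> 0 < tau ->
  rel_loss alpha d (1 / 2 * tau * Num.sqrt d%:R) phi @[d --> \oo] -->
  (\sum_(1 <= k < (Num.truncn phi).+1) (k%:R `^ (- alpha) - phi `^ (- alpha)) ^+ 2
     + 1 / tau ^+ 2 * phi `^ (- (2 * alpha))) / zeta (2 * alpha).
Proof.
move=> a12 tau0; have s1 : 1 < 2 * alpha by lra.
apply: cvgM; last first.
  by apply: cvgV; [rewrite gt_eqF// zeta_gt0|exact: power_sum_cvg_zeta].
apply: cvgD; first exact: cvg_cst.
apply: cvgMl.
have dy : (d%:R : R) @[d --> \oo] --> +oo by exact: cvgr_idn.
have lim : (d%:R - (Num.truncn phi)%:R) / d%:R / tau ^+ 2 @[d --> \oo] --> 1 / tau ^+ 2.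
  apply: cvgMl; apply: (cvg_ratio_bounded_diff (C := (Num.truncn phi)%:R)) dy _.
  by near=> d; rewrite mul1r addrC addKr normrN normr_nat.
apply: cvg_trans lim; apply: near_eq_cvg; near=> d.
rewrite !exprMn sqr_sqrtr// -mulrA -invfM; congr (_ / _).
by field.
Unshelve. all: by end_near. Qed.

(** * The three regimes with their prescribed scalings *)

Theorem theorem4p5 (R : realType) (alpha : R) (halpha : 0 < alpha) :
  [/\ alpha < 1 / 2 ->
        let c1 : R := 1 - 1 / (2 * alpha) in
        let c2 : R := alpha / (1 - alpha) in
        let T : nat -> R -> R := fun _ tau => tau in
        let phi : nat -> R -> R := fun d tau =>
          if tau ^+ 2 <= (1 - c1) / (4 * c2) then d%:R
          else d%:R * (c1 + 4 * c2 * tau ^+ 2)^-1 in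
        (forall tau : R, 0 < tau ->
           [/\ admissible phi tau, rel_loss_cvg alpha T phi tau &
               lim_rel_loss alpha T phi tau =
                 if tau ^+ 2 <= (1 - c1) / (4 * c2) then 2 * alpha * c2
                 else (c1 + 4 * c2 * tau ^+ 2) `^ (2 * alpha) / (4 * tau ^+ 2)])
        /\ asymp_equiv (lim_rel_loss alpha T phi)
             (fun tau => c2 `^ (2 * alpha) / (2 * tau) `^ (2 - 4 * alpha)),
      alpha = 1 / 2 ->
        let T : nat -> R -> R := fun d tau => 1 / 2 * d%:R `^ (tau / 2) in
        let phi : nat -> R -> R := fun d tau => d%:R `^ (1 - tau) in
        forall tau : R, 0 <= tau <= 1 ->
          [/\ admissible phi tau, rel_loss_cvg alpha T phi tau &
              lim_rel_loss alpha T phi tau = 1 - tau]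
    & 1 / 2 < alpha ->
        let T : nat -> R -> R := fun d tau => 1 / 2 * tau * Num.sqrt d%:R in
        let phi : nat -> R -> R := fun _ tau =>
          if (tau ^+ 2 < (2 `^ alpha - 1)^-1) && (alpha < 1)
          then 1 + 1 / tau ^+ 2
          else (1 + 1 / tau ^+ 2) `^ (1 / alpha) in
        (forall tau : R, 0 < tau ->
           admissible phi tau /\ rel_loss_cvg alpha T phi tau)
        /\ asymp_equiv (lim_rel_loss alpha T phi)
             (fun tau => 1 / (1 + zeta (2 * alpha) * tau ^+ 2))].
Proof.
split=> [a12 c1 c2 T phi|ahalf T phi tau tau01|a12 T phi].
- have c20 : 0 < c2 by rewrite divr_gt0//; lra.
  have aa : 0 < alpha < 1 / 2 by rewrite halpha.
  have c24 : 0 < 4 * c2 by rewrite mulr_gt0.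
  (* [y] is the ratio d / phi; both branches of [phi] then fall under the sublinear limit with x =
     1/y. *)
  pose y (tau : R) := if tau ^+ 2 <= (1 - c1) / (4 * c2) then 1 else c1 + 4 * c2 * tau ^+ 2.
  have phiE d tau : phi d tau = d%:R * (y tau)^-1.
    by rewrite /phi /y; case: ifP => //; rewrite invr1 mulr1.
  have y1 tau : 1 <= y tau.
    rewrite /y; case: ifP => // /negbT; rewrite -ltNge ltr_pdivrMr// mulrC => lt.
    by rewrite -lerBlDl ltW.
  have main tau : 0 < tau ->
      rel_loss alpha d (T d tau) (phi d tau) @[d --> \oo] -->
        (if tau ^+ 2 <= (1 - c1) / (4 * c2) then 2 * alpha * c2
         else (c1 + 4 * c2 * tau ^+ 2) `^ (2 * alpha) / (4 * tau ^+ 2)).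
    move=> t0; under eq_fun do rewrite phiE.
    have y0 : 0 < y tau := lt_le_trans ltr01 (y1 tau).
    have yV0 : 0 < (y tau)^-1 by rewrite invr_gt0.
    rewrite (_ : (if _ then _ else _) = (y tau)^-1 `^ (1 - 2 * alpha) *
        (2 * alpha * (alpha / (1 - alpha))
         + (1 - 2 * alpha) * ((y tau)^-1^-1 - 1) / (4 * tau ^+ 2))); last first.
      move: y0 {yV0}; rewrite invrK /y; case: ifP => [_ _|_ y0].
        by rewrite invr1 powR1 subrr mulr0 mul0r addr0 mul1r.
      set z := c1 + _ in y0 *.
      have -> : z^-1 `^ (1 - 2 * alpha) = z `^ (2 * alpha) / z.
        rewrite -{1}(powR_inv1 (ltW y0)) -powRrM mulN1r opprB.
        by rewrite powRB ?(lt0r_neq0 y0) ?implybT// powRr1// ltW.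
      (* Eliminating c2 through z, and since 2 alpha c1 = 2 alpha - 1, the bracket collapses to z /
         (4 tau^2). *)
      have -> : alpha / (1 - alpha) = (z - c1) / (4 * tau ^+ 2).
        by rewrite /z [c1 + _]addrC addrK -/c2; field; exact: lt0r_neq0.
      rewrite /c1; field.
      by rewrite (lt0r_neq0 y0) (lt0r_neq0 t0) (lt0r_neq0 halpha).
    exact: rel_loss_sublinear_cvg.
  split.
    move=> tau t0; have m := main _ t0; split.
    - near=> d; rewrite phiE.
      have y0 : 0 < y tau := lt_le_trans ltr01 (y1 tau).
      rewrite ler_pdivlMr// mul1r ler_pdivrMr// ler_peMr// andbT.
      by near: d; exact: nbhs_infty_ger.
    - by apply/cvg_ex; eexists; exact: m.
    - exact: (cvg_lim (@Rhausdorff R) m).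
  apply: cvg_trans (rel_loss_sublinear_asymp alpha c1 c20).
  apply: near_eq_cvg; near=> tau.
  have t0 : 0 < tau by near: tau; apply: nbhs_pinfty_gt; exact: num_real.
  (* From here tau <= tau^2, so tau beyond the threshold already selects the second branch. *)
  have t1 : 1 <= tau by near: tau; apply: nbhs_pinfty_ge; exact: num_real.
  rewrite /lim_rel_loss (cvg_lim (@Rhausdorff R) (main _ t0)).
  case: ifP => // tc; suff : (1 - c1) / (4 * c2) < tau ^+ 2 by rewrite ltNge tc.
  have lt : (1 - c1) / (4 * c2) < tau by near: tau; apply: nbhs_pinfty_gt; exact: num_real.
  by rewrite (lt_le_trans lt)// expr2 ler_peMl// ltW.
- rewrite ahalf; have m := rel_loss_critical_cvg tau01; split.
  - have /andP[tau0 tau1] := tau01; near=> d.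
    have d1 : 1 <= (d%:R : R) by near: d; exact: nbhs_infty_ger.
    apply/andP; split; first by rewrite -[leLHS](powRr0 d%:R) ler_powR// subr_ge0.
    by rewrite -[leRHS]powRr1// ler_powR// gerBl.
  - by apply/cvg_ex; eexists; exact: m.
  - exact: (cvg_lim (@Rhausdorff R) m).
- have s1 : 1 < 2 * alpha by lra.
  have base1 (tau : R) : 0 < tau -> 1 <= 1 + 1 / tau ^+ 2 :> R.
    by move=> t0; rewrite lerDl divr_ge0// sqr_ge0.
  split=> [tau t0|].
    split; last by apply/cvg_ex; eexists; exact: rel_loss_supercritical_cvg.
    (* [phi] ignores its first argument, so index 0 stands for every d. *)
    have phi1 : 1 <= phi 0%N tau.
      rewrite /phi; case: ifP => _; first exact: base1.
      by rewrite -[leLHS](powRr0 (1 + 1 / tau ^+ 2)) ler_powR ?base1// divr_ge0// ltW.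
    near=> d; rewrite -/(phi 0%N tau) phi1 /=.
    by near: d; exact: nbhs_infty_ger.
  have sq_cvgy := @sqr_cvgy R.
  have z0 := zeta_gt0 s1.
  (* The quotient to be studied once r(tau) is known for large tau; numerator and denominator differ
     by the constant 1 - zeta(2 alpha). *)
  have lim : (1 + zeta (2 * alpha) * tau ^+ 2) / (zeta (2 * alpha) * (1 + tau ^+ 2))
      @[tau --> +oo] --> (1 : R).
    apply: (cvg_ratio_bounded_diff (C := `|1 - zeta (2 * alpha)|)).
      apply: gt0_cvgMry => //; apply: ger_cvgy sq_cvgy; near=> tau.
      by rewrite lerDr.
    near=> tau; rewrite mul1r mulrDr mulr1.
    by rewrite (_ : _ - _ = 1 - zeta (2 * alpha))//; ring.
  apply: cvg_trans lim; apply: near_eq_cvg; near=> tau.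
  have t0 : 0 < tau by near: tau; apply: nbhs_pinfty_gt; exact: num_real.
  have tw : 1 < 2 `^ alpha :> R.
    have : 1 `^ alpha < 2 `^ alpha by rewrite gt0_ltr_powR ?nnegrE ?ltr1n.
    by rewrite powR1.
  (* This selects the second branch of [phi] and, being equivalent to 1 + 1/tau^2 < 2^alpha, also
     forces phi < 2. *)
  have large : (2 `^ alpha - 1)^-1 < tau ^+ 2.
    by near: tau; move/cvgryPgt: sq_cvgy; exact.
  have m := @rel_loss_supercritical_cvg R alpha tau (phi 0%N tau) a12 t0.
  rewrite /lim_rel_loss (cvg_lim (@Rhausdorff R) m) {m}.
  have u0 : 0 < 1 + 1 / tau ^+ 2 := lt_le_trans ltr01 (base1 _ t0).
  have -> : phi 0%N tau = (1 + 1 / tau ^+ 2) `^ (1 / alpha) by rewrite /phi ltNge ltW.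
  set p := (1 + 1 / tau ^+ 2) `^ (1 / alpha).
  have pa : p `^ (- alpha) = (1 + 1 / tau ^+ 2)^-1.
    rewrite -powRrM -(powR_inv1 (ltW u0)); congr (_ `^ _).
    by field; exact: lt0r_neq0.
  have p2 : p < 2.
    have -> : 2 = (2 `^ alpha) `^ (1 / alpha) :> R.
      by rewrite -powRrM mulrC divfK ?powRr1// lt0r_neq0.
    rewrite gt0_ltr_powR ?divr_gt0// ?nnegrE ?powR_ge0// ?(ltW u0)//.
    rewrite -ltrBrDl div1r -[ltRHS]invrK ltf_pV2// posrE ?exprn_gt0//.
    by rewrite invr_gt0 subr_gt0.
  have p1 : 1 <= p.
    by rewrite /p -[leLHS](powRr0 (1 + 1 / tau ^+ 2)) ler_powR ?base1// divr_ge0// ltW.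
  (* Only k = 1 survives. With q = p^-alpha = tau^2 / (1 + tau^2), the numerator (1 - q)^2 + q^2 /
     tau^2 equals 1 / (1 + tau^2). *)
  rewrite (truncn_def (n := 1)) ?p1// big_nat1 powR1.
  have -> : - (2 * alpha) = 2 * - alpha by rewrite mulrN.
  rewrite -powR_sqr pa; field.
  by rewrite !lt0r_neq0 ?addr_gt0 ?mulr_gt0 ?exprn_gt0.
Unshelve. all: by end_near. Qed.
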